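(* Let $n\geq 2$ and $p\in\mathbb{Z}^{+}$, and let $A=(a_1,a_2,\ldots,a_n)$ be a sequence of positive integers with $\gcd(a_1,\ldots,a_n)=1$ such that, for each $1\leq i\leq n$, $a_i=pk_i+t_i$ with $k_i\in\mathbb{N}$ and $t_i$ an integer satisfying $1\leq t_i\leq p-1$. Let $$\mathcal{T}_p=\left\{(x_1,x_2,\ldots,x_n)\in\mathbb{Z}^n \;\Big|\; 0\leq x_1,x_2,\ldots,x_n\leq p-1,\ \ p\ \Big|\ \sum_{i=1}^n x_it_i,\ \ \sum_{i=1}^n x_it_i\neq 0\right\}.$$ Then $$\frac{\langle A\rangle}{p}=\left\langle a_1,a_2,\ldots,a_n,\ \frac{1}{p}\sum_{i=1}^n x_ia_i\ \Big|\ (x_1,x_2,\ldots,x_n)\in\mathcal{T}_p\right\rangle,$$ i.e. the elements $a_1,\ldots,a_n$ together with all the elements $\frac1p\sum_{i=1}^n x_ia_i$ for $(x_1,\ldots,x_n)\in\mathcal{T}_p$ form a system of generators of the quotient of the numerical semigroup $\langle A\rangle$ by $p$.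
   Context: $\mathbb{N}$ denotes the non-negative integers and $\mathbb{Z}^{+}$ the positive integers. For a collection of positive integers, $\langle\,\cdot\,\rangle$ denotes the set of all finite linear combinations of its elements with coefficients in $\mathbb{N}$ (the submonoid of $(\mathbb{N},+)$ generated by them); these elements are then called a system of generators of that set (not necessarily minimal). In particular $\langle A\rangle=\{x_1a_1+\cdots+x_na_n\mid x_i\in\mathbb{N}\}$. The quotient of $\langle A\rangle$ by $p\in\mathbb{Z}^+$ is $\frac{\langle A\rangle}{p}=\{m\in\mathbb{N}\mid pm\in\langle A\rangle\}$. *)

(* Defs.v *)
From mathcomp Require Import all_boot.
From mathcomp Require Import classical_sets.

Set Implicit Arguments.
Unset Strict Implicit.
Unset Printing Implicit Defensive.

Local Open Scope classical_set_scope.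

(* Submonoid of (nat, +) generated by S; r = 0 gives the empty combination. *)
Definition generated (S : set nat) : set nat :=
  [set m | exists (r : nat) (c g : 'I_r -> nat),
     (forall j, S (g j)) /\ m = \sum_(j < r) c j * g j].

Definition quotient_by (M : set nat) (p : nat) : set nat :=
  [set m | M (p * m)].

(* The integer vectors of T_p have entries in [0, p - 1], hence are taken
   nat-valued. *)
Definition Tset (n p : nat) (t : 'I_n -> nat) : set ('I_n -> nat) :=
  [set x | [/\ forall i, 0 <= x i <= p - 1,
               p %| \sum_(i < n) x i * t i
             & \sum_(i < n) x i * t i <> 0]].

(* The value (1/p) * sum_i x_i a_i; the Euclidean division is exact for x in
   Tset p t, see [weightedK]. *)
Definition weighted (n p : nat) (a x : 'I_n -> nat) : nat :=
  (\sum_(i < n) x i * a i) %/ p.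

Lemma weightedK (n p : nat) (a k t x : 'I_n -> nat) :
    (forall i, a i = p * k i + t i) -> Tset p t x ->
  weighted p a x * p = \sum_(i < n) x i * a i.
Proof.
move=> aE [_ pt _]; rewrite /weighted divnK //.
under eq_bigr do rewrite aE mulnDr.
by rewrite big_split dvdn_add //= dvdn_sum // => i _; rewrite mulnCA dvdn_mulr.
Qed.

Lemma generated_range (n : nat) (a : 'I_n -> nat) :
  generated (range a) =
  [set m | exists x : 'I_n -> nat, m = \sum_(i < n) x i * a i].
Proof.
apply/seteqP; split=> m /=; last first.
  by move=> [x ->]; exists n, x, a; split=> // j; exists j.
move=> [r [c [g [gA ->]]]]; elim: r c g gA => [|r IH] c g gA.
  by exists (fun=> 0); rewrite big_ord0 big1.
have [x xE] := IH (c \o lift ord0) (g \o lift ord0) (fun j => gA _).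
have [i _ gE] := gA ord0.
exists (fun j => (j == i) * c ord0 + x j).
rewrite big_ord_recl xE; under [RHS]eq_bigr do rewrite mulnDl.
rewrite big_split /=; congr (_ + _).
rewrite (bigD1 i) //= eqxx mul1n gE big1 ?addn0 // => j /negPf ->.
by rewrite mul0n.
Qed.

(* Main.v *)
(* Reducing the coefficients of a representation p m = \sum_i x_i a_i modulo p
   splits m into a combination of the a_i, whose coefficients are the quotients,
   and (1/p) \sum_i r_i a_i, where r is the vector of remainders.  Since
   a_i = t_i mod p, r lies in T_p unless \sum_i r_i t_i = 0, and then r = 0. *)
Require Import Defs.
From mathcomp Require Import all_boot.
From mathcomp Require Import classical_sets.

Local Open Scope classical_set_scope.

Lemma generated0 (S : set nat) : generated S 0.
Proof.
by exists 0, (fun=> 0), (fun=> 0); split=> [[]//|]; rewrite big_ord0.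
Qed.

Lemma generatedD (S : set nat) (m1 m2 : nat) :
  generated S m1 -> generated S m2 -> generated S (m1 + m2).
Proof.
move=> [r1 [c1 [g1 [Sg1 ->]]]] [r2 [c2 [g2 [Sg2 ->]]]].
(* Two combinations are added by concatenating their families of coefficients and of generators. *)
pose cat (f1 : 'I_r1 -> nat) (f2 : 'I_r2 -> nat) (j : 'I_(r1 + r2)) :=
  match fintype.split j with inl i => f1 i | inr i => f2 i end.
have catl f1 f2 i : cat f1 f2 (lshift r2 i) = f1 i.
  by rewrite /cat (unsplitK (inl i)).
have catr f1 f2 i : cat f1 f2 (rshift r1 i) = f2 i.
  by rewrite /cat (unsplitK (inr i)).
exists (r1 + r2), (cat c1 c2), (cat g1 g2); split.
  by move=> j; rewrite /cat; case: fintype.split.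
by rewrite big_split_ord; congr (_ + _); apply: eq_bigr => i _;
  rewrite ?catl ?catr.
Qed.

Lemma sub_generated (S : set nat) : S `<=` generated S.
Proof.
by move=> m Sm; exists 1, (fun=> 1), (fun=> m); rewrite big_ord1 mul1n.
Qed.

Lemma generated_min (S M : set nat) :
    M 0 -> (forall m1 m2, M m1 -> M m2 -> M (m1 + m2)) -> S `<=` M ->
  generated S `<=` M.
Proof.
move=> M0 MD SM _ [r [c [g [Sg ->]]]]; apply: (big_ind M) => // j _.
(* [M] is closed under addition only, so [c j * g j] is built as a repeated sum of [g j]. *)
by elim: (c j) => [|l IHl]; rewrite ?mul0n // mulSn; apply: MD IHl; apply: SM.
Qed.

Lemma generated_sub (S1 S2 : set nat) :
  S1 `<=` S2 -> generated S1 `<=` generated S2.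
Proof.
move=> S12; apply: generated_min; first exact: generated0.
- exact: generatedD.
- by move=> m /S12; apply: sub_generated.
Qed.

(** The quotient is itself a submonoid, so an inclusion into it can be tested on generators. *)
Lemma quotient_generated_min (S S' : set nat) (p : nat) :
    S' `<=` quotient_by (generated S) p ->
  generated S' `<=` quotient_by (generated S) p.
Proof.
apply: generated_min; rewrite /quotient_by /=.
  by rewrite muln0; apply: generated0.
by move=> m1 m2; rewrite mulnDr; apply: generatedD.
Qed.

Lemma sub_quotient_generated (S : set nat) (p : nat) :
  generated S `<=` quotient_by (generated S) p.
Proof.
move=> m Sm; rewrite /quotient_by /=.
elim: p => [|p IHp]; first by rewrite mul0n; apply: generated0.
by rewrite mulSn; apply: generatedD.
Qed.

(** The two sums differ by the multiple [p * \sum_i x i * k i] of [p]. *)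
Lemma dvdn_sum_residue (n p : nat) (a k t x : 'I_n -> nat) :
    (forall i, a i = p * k i + t i) ->
  (p %| \sum_(i < n) x i * a i) = (p %| \sum_(i < n) x i * t i).
Proof.
move=> aE; under eq_bigr do rewrite aE mulnDr mulnCA.
by rewrite big_split -big_distrr /= dvdn_addr // dvdn_mulr.
Qed.

Theorem theorem1p1 (n p : nat) (a k t : 'I_n -> nat)
    (hn : 2 <= n) (hp : 0 < p)
    (ha : forall i, 0 < a i)
    (hgcd : \big[gcdn/0]_(i < n) a i = 1)
    (hak : forall i, a i = p * k i + t i)
    (ht : forall i, 1 <= t i <= p - 1) :
  quotient_by (generated (range a)) p =
  generated (range a `|` [set weighted p a x | x in Tset p t]).
Proof.
apply/seteqP; split; last first.
  (* Each [a i] already lies in the semigroup, and [p] times a weighted element is the combination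
     of the [a i] with coefficients [x]. *)
  apply: quotient_generated_min => m [/sub_generated|[x xT <-]].
    exact: sub_quotient_generated.
  rewrite /quotient_by /= mulnC (weightedK hak xT) generated_range.
  by exists x.
move=> m; rewrite /quotient_by /= {1}generated_range => -[x xE].
pose q i := x i %/ p; pose r i := x i %% p.
have pmE : p * m = p * (\sum_(i < n) q i * a i) + \sum_(i < n) r i * a i.
  rewrite xE big_distrr -big_split; apply: eq_bigr => i _ /=.
  by rewrite mulnA -mulnDl [p * _]mulnC -divn_eq.
(* In [pmE] both other terms are multiples of [p]; the division in [weighted p a r] is therefore
   exact. *)
have p_dvd : p %| \sum_(i < n) r i * a i.
  by rewrite -(dvdn_addr _ (dvdn_mulr (\sum_(i < n) q i * a i) (dvdnn p)))
    -pmE dvdn_mulr.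
have -> : m = \sum_(i < n) q i * a i + weighted p a r.
  by apply/eqP; rewrite -(eqn_pmul2l hp) mulnDr pmE /weighted [p * (_ %/ _)]mulnC
    divnK.
apply: generatedD.
  apply: (generated_sub (range a)); first by move=> y; left.
  by rewrite generated_range; exists q.
have [/eqP|/eqP rt_neq0] := eqVneq (\sum_(i < n) r i * t i) 0.
  (* Every [r i * t i] vanishes while [t i] is positive, so [r] is 0 and the weighted part
     contributes 0. *)
  rewrite sum_nat_eq0 => /forallP rt0.
  rewrite /weighted big1 ?div0n => [|i _]; first exact: generated0.
  have := rt0 i; rewrite muln_eq0 => /orP[/eqP->//|/eqP ti0].
  by have := ht i; rewrite ti0.
apply: sub_generated; right; exists r => //; split=> //.
(* As [p] is positive, the bound [p - 1] amounts to [r i < p]. *)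
- by move=> i; rewrite -(ltnS (r i)) subn1 prednK //= ltn_pmod.
- by rewrite -(dvdn_sum_residue _ _ _ _ _ _ hak).
Qed.
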